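(* Let $k\ge3$ be an integer, $\lambda=\lambda_k=2\cos(\pi/k)$, and let $0\le p\le 1/k$. Let $\widetilde F_1>0$, $\widetilde F_2>0$ and, for $n\ge1$, $\widetilde F_{n+2}=|\lambda\widetilde F_{n+1}\pm\widetilde F_n|$, where the $\pm$ signs are independent, each being $+$ with probability $p$ and $-$ with probability $1-p$. Then almost surely there exists a bounded subsequence $(\widetilde F_{n_j})_j$ of $(\widetilde F_n)$ with density $1-kp$.
   Context: A subsequence $(\widetilde F_{n_j})$ (with $n_1<n_2<\cdots$) has density $d$ if the set of indices $\{n_j\}$ has natural density $d$, i.e. $\frac1N\#\{j: n_j\le N\}\to d$ as $N\to\infty$ (equivalently, $j/n_j\to d$). *)

(* Defs.v *)
From mathcomp Require Import all_boot all_order all_algebra.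
From mathcomp Require Import finmap.
From mathcomp Require Import all_classical all_reals all_analysis.
Set Implicit Arguments.
Unset Strict Implicit.
Unset Printing Implicit Defensive.
Import Order.TTheory GRing.Theory Num.Theory.
Import numFieldNormedType.Exports.
Local Open Scope classical_set_scope.
Local Open Scope ring_scope.

Definition mutually_independent_RV d (T : measurableType d) (R : realType)
    (P : probability T R) (D : set nat) (X : nat -> {RV P >-> R}) : Prop :=
  forall (J : {fset nat}) (B : nat -> set R),
    [set` J] `<=` D ->
    (forall i, i \in J -> measurable (B i)) ->
    P (\bigcap_(i in [set` J]) (X i @^-1` B i))
      = (\prod_(i <- J) P (X i @^-1` B i))%E.

(* The indicator sum is #(A `&` {1, ..., N}). *)
Definition has_natural_density (R : realType) (A : set nat) (delta : R) : Prop :=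
  (fun N : nat => (\sum_(1 <= m < N.+1) \1_A m) / N%:R : R) @ \oo --> delta.

(* The signs are eps 1, eps 2, ... and the sequence is F 1, F 2, ...;
   F 0 and eps 0 are unconstrained and irrelevant. *)
Definition random_fibonacci (T : Type) (R : realType) (lambda : R)
    (eps : nat -> T -> R) (F : nat -> T -> R) : Prop :=
  forall (n : nat) (w : T), (1 <= n)%N ->
    F n.+2 w = `|lambda * F n.+1 w + eps n w * F n w|.

(* Main.v *)
Require Import Defs.
From mathcomp Require Import all_boot all_order all_algebra.
From mathcomp Require Import finmap.
From mathcomp Require Import all_classical all_reals all_analysis.
From mathcomp Require Import zify ring lra.
Set Implicit Arguments.
Unset Strict Implicit.
Unset Printing Implicit Defensive.
Import Order.TTheory GRing.Theory Num.Theory.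
Import numFieldNormedType.Exports.
Local Open Scope classical_set_scope.
Local Open Scope ring_scope.

(** Record the signs as booleans, [true] for plus.  Step [n] sends the pair
    [(F n, F n.+1)] to [(F n.+1, F n.+2)].  The choice of lambda makes the minus
    step without absolute value a linear map whose [k]-th power is [-1], and a
    plus step is a minus step applied to [(- x, y)].  So a plus followed by
    [k.-1] minuses maps [(x, y)] to [(x, - y)], which the absolute value turns
    back into [(x, y)] when the pair is nonnegative; no earlier step of the
    block produces a negative number.  Such blocks may be nested, so the signs
    can be read like brackets: a plus opens a debt of [k.-1] minuses and every
    minus pays one unit of the latest debt.  [height k b n] is
    the outstanding debt after [n] steps.  Deleting the completed blocks
    ([reduced], [reduced_step]) leaves, whenever the height is [0], a pair which
    was produced by minus steps alone.  Minus steps, with their absolute value,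
    do not increase the energy [x ^+ 2 + y ^+ 2 - lambda * x * y], which is
    positive definite because lambda < 2; so the sequence is bounded along the
    times of height [0] ([reduced0_bounded]).

    The subsequence consists of the [idle] times, at which a minus finds no debt
    to pay.  Balancing the debt gives
    [idle steps = height + N - k * (number of plus signs)], up to time [N].  The
    strong law of large numbers handles the last two terms, and since the debt
    has drift [k * p - 1 <= 0], a reflected walk argument shows that the height
    is negligible compared with [N]: this is [idle_density], and the density is
    [1 - k * p].

    If [k * p = 1] the density is [0] and says nothing about the infinitude of
    the idle times.  Infinitude is the recurrence of a random walk, skip-free to
    the left, with nonpositive drift: an exponential supermartingale bounds the
    probability that a debt [h] is never cleared by [1 - v ^+ h.+1] for every
    [v < 1] ([wprob_survives]).

    All the probability goes through [prob_window]: an event about finitely many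
    consecutive signs has the probability computed by the recursion [wprob] on
    words.  Both the recurrence and the Chernoff bound behind the strong law
    are then inductions on the length of words. *)

(** * The outstanding debt and the idle times *)

Fixpoint height (k : nat) (b : nat -> bool) (n : nat) : nat :=
  if n is m.+1 then
    if b n then (height k b m + k.-1)%N else (height k b m).-1
  else 0%N.

Definition idle (k : nat) (b : nat -> bool) (n : nat) : bool :=
  [&& (0 < n)%N, height k b n.-1 == 0%N & ~~ b n].

Lemma count_iotaS (a : pred nat) N :
  count a (iota 1 N.+1) = (count a (iota 1 N) + a N.+1)%N.
Proof. by rewrite -[N.+1]addn1 iotaD count_cat /= addn0 add1n addn1. Qed.

(** Each plus adds [k.-1] to the debt and each minus removes [1], except at idle
    times; with the [N] steps moved to the left, a plus counts for [k] and an
    idle step for [1]. *)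
Lemma height_balance k b N : (0 < k)%N ->
  (height k b N + N = k * count b (iota 1 N) + count (idle k b) (iota 1 N))%N.
Proof.
case: k => // k _; elim: N => [|N IH]; first by rewrite muln0.
rewrite !count_iotaS mulnDr addnACA -IH /idle /=.
case: (b N.+1) => /=; first by rewrite andbF; lia.
by rewrite andbT; case: eqP => /= h0; lia.
Qed.

(** The height is a reflected walk: with [m] the last idle time (or [0]), it is
    the increment of the unreflected walk since [m]. *)
Lemma height_since_idle k b N : (0 < k)%N -> exists2 m, (m <= N)%N &
  (height k b N + N + k * count b (iota 1 m) = k * count b (iota 1 N) + m)%N.
Proof.
case: k => // k _; elim: N => [|N [m mN IH]];
  first by (exists 0%N; [done | rewrite ?muln0 ?addn0 ?add0n]).
have [/andP[h0 bN]|hb] := boolP ((height k.+1 b N == 0%N) && ~~ b N.+1).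
  by exists N.+1 => //=; rewrite (negbTE bN) (eqP h0) /= add0n addnC.
exists m; first by lia.
rewrite count_iotaS mulnDr /=; move: IH hb.
by case: (b N.+1) => /=; rewrite ?andbT; lia.
Qed.

Lemma height_le k b n : (height k b n <= k.-1 * n)%N.
Proof. by elim: n => [|n IH] //=; case: (b n.+1); nia. Qed.

(** Starting from debt [h], no idle step occurs while [s] is read. *)
Fixpoint survives (k h : nat) (s : seq bool) : bool :=
  match s with
  | [::] => true
  | true :: s' => survives k (h + k.-1)%N s'
  | false :: s' => if h is h'.+1 then survives k h' s' else false
  end.

Lemma survives_homo k s h h' :
  (h <= h')%N -> survives k h s -> survives k h' s.
Proof.
elim: s h h' => [|[] s IH] //= h h' hh'; first by apply: IH; lia.
by case: h h' hh' => [|h] [|h'] //= hh'; apply: IH.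
Qed.

Lemma survives_no_idle k b n N : (forall m, (n < m)%N -> ~~ idle k b m) ->
  survives k (height k b n) [seq b i | i <- iota n.+1 N].
Proof.
elim: N n => [|N IH] n noidle //=.
have {}IH : survives k (height k b n.+1) [seq b i | i <- iota n.+2 N].
  by apply: IH => m nm; apply: noidle; lia.
have := noidle n.+1 (ltnSn n); move: IH; rewrite /idle /=.
by case: (b n.+1) => //=; case: (height k b n).
Qed.

(** The increasing enumeration is obtained by always taking the least next
    element; [below] shows that it skips none. *)
Lemma enumerate_infinite (a : pred nat) :
  (forall n, exists m, (n <= m)%N && a m) ->
  exists nu : nat -> nat,
    (forall j, (nu j < nu j.+1)%N) /\ range nu = [set m | a m].
Proof.
move=> ainf.
pose next n := ex_minn (ainf n).
have nextP n : [/\ (n <= next n)%N, a (next n) &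
    forall m, (n <= m)%N -> a m -> (next n <= m)%N].
  rewrite /next; case: ex_minnP => m /andP[nm am] mmin; split=> // i ni ai.
  by apply: mmin; rewrite ni.
pose fix nu j := if j is i.+1 then next (nu i).+1 else next 0%N.
have nuS j : (nu j < nu j.+1)%N by have [] := nextP (nu j).+1.
have nu_ge j : (j <= nu j)%N.
  by elim: j => // j IH; exact: leq_ltn_trans IH (nuS j).
have below j m : a m -> (m < nu j)%N -> exists2 i, (i < j)%N & nu i = m.
  move=> am; elim: j => [|j IH] mj.
    by have [_ _ /(_ m isT am)] := nextP 0%N; move: mj => /=; lia.
  have [/IH[i ij <-]|] := ltnP m (nu j); first by exists i; rewrite // ltnW.
  rewrite leq_eqVlt => /orP[/eqP<-|jm]; first by exists j.
  by have [_ _ /(_ m jm am)] := nextP (nu j).+1; move: mj => /=; lia.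
exists nu; split=> //; apply/seteqP; split=> [_ [j _ <-]|m /= am].
  by case: j => [|j] /=; [have [] := nextP 0%N | have [] := nextP (nu j).+1].
have [i _ <-] : exists2 i, (i < m.+1)%N & nu i = m.
  by apply: below => //; exact: leq_ltn_trans (nu_ge m) (nuS m).
by exists i.
Qed.

(** * Boundedness when the debt vanishes *)

(** The diagonal of a regular [k]-gon which spans [j] sides, in units of the
    side; also the Chebyshev polynomial of the second kind of degree [j - 1] at
    [cos (pi / k)]. *)
Definition chord (R : realType) (k j : nat) : R :=
  sin (j%:R * (pi / k%:R)) / sin (pi / k%:R).

Lemma sin_pi_div_gt0 (R : realType) k : (1 < k)%N -> 0 < sin (pi / k%:R : R).
Proof.
move=> k1; apply: sin_gt0_pi.
rewrite divr_gt0 ?pi_gt0 ?ltr0n 1?ltnW //=.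
by rewrite ltr_pdivrMr ?ltr0n 1?ltnW // ltr_pMr ?pi_gt0 // ltr1n.
Qed.

Lemma chord0 (R : realType) k : chord R k 0 = 0.
Proof. by rewrite /chord mul0r sin0 mul0r. Qed.

Lemma chord1 (R : realType) k : (1 < k)%N -> chord R k 1 = 1.
Proof. by move=> k1; rewrite /chord mul1r divff // gt_eqF // sin_pi_div_gt0. Qed.

Lemma chord_rec (R : realType) k j :
  chord R k j.+2 = 2 * cos (pi / k%:R) * chord R k j.+1 - chord R k j.
Proof.
rewrite /chord; set t := pi / k%:R.
have -> : j.+2%:R * t = j.+1%:R * t + t by rewrite -natr1; ring.
have -> : j%:R * t = j.+1%:R * t - t by rewrite -natr1; ring.
rewrite sinD sinB; ring.
Qed.

Lemma chord_pred (R : realType) k : (1 < k)%N -> chord R k k.-1 = 1.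
Proof.
move=> k1; rewrite /chord.
have k0 : k%:R != 0 :> R by rewrite pnatr_eq0; lia.
have -> : k.-1%:R * (pi / k%:R) = pi - pi / k%:R :> R.
  have -> : k.-1%:R = k%:R - 1 :> R
    by rewrite -[in RHS](prednK (ltnW k1)) -natr1 addrK.
  by field.
by rewrite sinB cospi sinpi mul0r mulN1r opprK add0r divff // gt_eqF // sin_pi_div_gt0.
Qed.

Lemma chord_last (R : realType) k : (0 < k)%N -> chord R k k = 0.
Proof.
move=> k0; rewrite /chord mulrCA divff ?pnatr_eq0; last by lia.
by rewrite mulr1 sinpi mul0r.
Qed.

Lemma chord_ge0 (R : realType) k j :
  (1 < k)%N -> (j <= k)%N -> 0 <= chord R k j.
Proof.
move=> k1 jk; apply: divr_ge0; last exact/ltW/sin_pi_div_gt0.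
have k0 : 0 < k%:R :> R by rewrite ltr0n; lia.
apply: sin_ge0_pi; apply/andP; split.
  by rewrite mulr_ge0 ?ler0n // divr_ge0 ?pi_ge0 ?ltW.
by rewrite mulrA ler_pdivrMr // mulrC ler_pM2l ?pi_gt0 // ler_nat.
Qed.

Definition nstep (R : realType) (lam : R) (b : bool) (v : R * R) : R * R :=
  (v.2, `|lam * v.2 + (if b then 1 else -1) * v.1|).

Definition energy (R : realType) (lam : R) (v : R * R) : R :=
  v.1 ^+ 2 + v.2 ^+ 2 - lam * v.1 * v.2.

Definition nonneg_pair (R : realType) (v : R * R) := (0 <= v.1) && (0 <= v.2).

(** The linear minus step preserves the energy; when its second coordinate is
    negative, the cross term of the energy of the new pair is nonnegative, and
    taking the absolute value changes its sign. *)
Lemma energy_nstep_minus (R : realType) (lam : R) (v : R * R) :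
  0 <= lam -> nonneg_pair v -> energy lam (nstep lam false v) <= energy lam v.
Proof.
case: v => x y lam0 /andP[/= x0 y0]; rewrite /energy /nstep /=.
rewrite real_normK ?num_real //.
have [z0|z0] := leP 0 (lam * y + -1 * x); first by rewrite ger0_norm //; nra.
rewrite ltr0_norm //.
have : 0 <= lam * y * (- (lam * y + -1 * x)) by rewrite !mulr_ge0 // oppr_ge0 ltW.
by nra.
Qed.

(** Complete the square in the second coordinate. *)
Lemma energy_bound (R : realType) k (v : R * R) : (1 < k)%N ->
  v.1 ^+ 2 <= energy (2 * cos (pi / k%:R)) v / sin (pi / k%:R) ^+ 2.
Proof.
move=> k1; case: v => x y; rewrite /energy /=.
rewrite ler_pdivlMr ?exprn_gt0 ?sin_pi_div_gt0 //.
have := sqr_ge0 (y - cos (pi / k%:R) * x).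
have := cos2Dsin2 (pi / k%:R : R).
by move=> cs; rewrite (_ : sin _ ^+ 2 = 1 - cos (pi / k%:R) ^+ 2); [nra|lra].
Qed.

(** The pair reached from [v] after one plus and [j] minuses, as long as no
    absolute value acts. *)
Definition excursion (R : realType) (k j : nat) (v : R * R) : R * R :=
  (v.2 * chord R k j.+1 + v.1 * chord R k j,
   v.2 * chord R k j.+2 + v.1 * chord R k j.+1).

Lemma excursion_nonneg (R : realType) k j (v : R * R) :
  (j.+1 < k)%N -> nonneg_pair v -> nonneg_pair (excursion k j v).
Proof.
move=> jk /andP[x0 y0].
by apply/andP; split; rewrite addr_ge0 // mulr_ge0 // chord_ge0 //; lia.
Qed.

Lemma nstep_plus (R : realType) k (v : R * R) : (2 < k)%N -> nonneg_pair v ->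
  nstep (2 * cos (pi / k%:R)) true v = excursion k 0 v.
Proof.
move=> k2 v0; have /andP[_] : nonneg_pair (excursion k 0 v).
  by apply: excursion_nonneg; lia.
rewrite /excursion /nstep /= chord_rec chord1 ?chord0; last by lia.
move=> y0; congr (_, _); first by ring.
by rewrite -[RHS]ger0_norm //; congr `|_|; ring.
Qed.

Lemma nstep_minus_excursion (R : realType) k j (v : R * R) :
  (j.+2 < k)%N -> nonneg_pair v ->
  nstep (2 * cos (pi / k%:R)) false (excursion k j v) = excursion k j.+1 v.
Proof.
move=> jk v0; have /andP[_] : nonneg_pair (excursion k j.+1 v).
  by apply: excursion_nonneg.
rewrite /excursion /nstep /= (chord_rec R k j.+1) (chord_rec R k j) => y0.
congr (_, _).
by rewrite -[RHS]ger0_norm //; congr `|_|; ring.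
Qed.

(** The block of one plus and [k.-1] minuses closes up.  The last linear step
    yields the opposite of the second coordinate of [v], which the absolute
    value repairs. *)
Lemma nstep_minus_excursion_last (R : realType) k (v : R * R) :
  (2 < k)%N -> nonneg_pair v ->
  nstep (2 * cos (pi / k%:R)) false (excursion k k.-2 v) = v.
Proof.
case: k => [|[|k]] // k2; case: v => x y /andP[/= x0 y0].
set c := 2 * cos _; rewrite /excursion /nstep /=.
have c1 : chord R k.+2 k.+1 = 1 by have := @chord_pred R k.+2 isT.
have c2 : chord R k.+2 k.+2 = 0 by apply: chord_last.
have c0 : chord R k.+2 k = c.
  by have := chord_rec R k.+2 k; rewrite c1 c2 -/c; lra.
rewrite c0 c1 c2 !(mulr0, mulr1) add0r; congr (_, _).
rewrite (_ : _ + _ = - y); last by ring.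
by rewrite normrN ger0_norm.
Qed.

(** [reduced k C h v]: after deletion of the completed blocks, [v] is obtained
    from a nonnegative pair of energy at most [C] by a stack of blocks in
    progress, of total debt [h].  A block which has seen [j] of its [k.-1]
    minuses owes [k.-1 - j], a positive amount, so that [h = 0] means that the
    stack is empty. *)
Inductive reduced (R : realType) (k : nat) (C : R) : nat -> R * R -> Prop :=
| Reduced_base v : nonneg_pair v -> energy (2 * cos (pi / k%:R)) v <= C ->
    reduced k C 0 v
| Reduced_push h j v : reduced k C h v -> (j.+1 < k)%N ->
    reduced k C (h + (k.-1 - j)) (excursion k j v).

Lemma reduced_nonneg (R : realType) k (C : R) h v :
  reduced k C h v -> nonneg_pair v.
Proof. by elim=> // {}h j {}v _ v0 jk; apply: excursion_nonneg. Qed.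

Lemma cos_pi_div_ge0 (R : realType) k : (1 < k)%N -> 0 <= cos (pi / k%:R : R).
Proof.
move=> k1; apply: cos_ge0_pihalf; have pi0 := pi_ge0 R; apply/andP; split.
  by rewrite (@le_trans _ _ 0) ?oppr_le0 ?divr_ge0.
by rewrite ler_wpM2l // lef_pV2 ?posrE ?ltr0n ?ler_nat //; lia.
Qed.

(** A plus opens a new block.  A minus advances the innermost block or closes
    it, and if there is none it acts on the base pair, whose energy does not
    increase. *)
Lemma reduced_step (R : realType) k (C : R) h v b : (2 < k)%N ->
  reduced k C h v ->
  reduced k C (if b then h + k.-1 else h.-1)%N
    (nstep (2 * cos (pi / k%:R)) b v).
Proof.
move=> k2 hv; have v0 := reduced_nonneg hv; case: b.
  by rewrite nstep_plus // -[k.-1]subn0; apply: Reduced_push => //; lia.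
case: {h v} hv v0 => [v v0 vC _|h j v hv jk _].
  apply: Reduced_base; last first.
    by apply: le_trans vC; apply: energy_nstep_minus;
      rewrite ?mulr_ge0 ?cos_pi_div_ge0 //; lia.
  by case/andP: v0 => _ v2; rewrite /nonneg_pair /nstep /= v2 normr_ge0.
have v0 := reduced_nonneg hv.
have [jk2|jk2] := ltnP j.+2 k.
  rewrite nstep_minus_excursion //.
  have -> : ((h + (k.-1 - j)).-1 = h + (k.-1 - j.+1))%N by lia.
  exact: Reduced_push.
have -> : j = k.-2 by lia.
rewrite nstep_minus_excursion_last //.
by have -> : ((h + (k.-1 - k.-2)).-1 = h)%N by lia.
Qed.

Lemma reduced0_bounded (R : realType) k (C : R) v : (1 < k)%N ->
  reduced k C 0 v -> v.1 <= 1 + C / sin (pi / k%:R) ^+ 2.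
Proof.
move=> k1; move h0 : 0%N => h hv;
case: hv h0 => [{}v /andP[v0 _] vC _|{}h j {}v _ jk]; last by lia.
have : v.1 ^+ 2 <= C / sin (pi / k%:R) ^+ 2.
  apply: le_trans (energy_bound v k1) _.
  by rewrite ler_wpM2r // invr_ge0 exprn_ge0 // ltW // sin_pi_div_gt0.
have := sqr_ge0 (v.1 - 1); nra.
Qed.

Lemma reduced_orbit (R : realType) k (b : nat -> bool) (C : R) (f : nat -> R) :
  (2 < k)%N -> nonneg_pair (f 1%N, f 2%N) ->
  energy (2 * cos (pi / k%:R)) (f 1%N, f 2%N) <= C ->
  (forall n, (0 < n)%N -> f n.+2 =
     `|2 * cos (pi / k%:R) * f n.+1 + (if b n then 1 else -1) * f n|) ->
  forall n, reduced k C (height k b n) (f n.+1, f n.+2).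
Proof.
move=> k2 f0 fC fS; elim=> [|n IH]; first exact: Reduced_base.
by rewrite (fS n.+1) //; exact: (reduced_step (b n.+1) k2 IH).
Qed.

(** * Probabilities of sets of sign words *)

(** The probability that a word of [N] independent signs, each plus with
    probability [p], satisfies [A]. *)
Fixpoint wprob (R : realType) (p : R) (N : nat) (A : seq bool -> bool) : R :=
  if N is N'.+1 then
    p * wprob p N' (fun s => A (true :: s)) +
    (1 - p) * wprob p N' (fun s => A (false :: s))
  else (A [::])%:R.

Lemma eq_wprob (R : realType) (p : R) N (A B : seq bool -> bool) :
  A =1 B -> wprob p N A = wprob p N B.
Proof. by move=> /funext ->. Qed.

Lemma wprob_false (R : realType) (p : R) N : wprob p N (fun=> false) = 0.
Proof. by elim: N => //= N ->; rewrite !mulr0 addr0. Qed.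

Lemma wprob_le1 (R : realType) (p : R) N A : 0 <= p <= 1 -> wprob p N A <= 1.
Proof.
move=> /andP[p0 p1]; elim: N A => [|N IH] A /=; first by rewrite lern1; case: (A _).
have := IH (fun s => A (true :: s)); have := IH (fun s => A (false :: s)); nra.
Qed.

(** The exponential Markov inequality for a binomial variable: the right-hand
    side is multiplicative along the recursion which defines [wprob]. *)
Lemma wprob_count_ge (R : realType) (p : R) (c t : R) (b : bool) N :
  0 <= p <= 1 -> 0 <= t ->
  wprob p N (fun s => c <= (count (pred1 b) s)%:R) <=
  expR (- (t * c)) * (1 + (if b then p else 1 - p) * (expR t - 1)) ^+ N.
Proof.
move=> /andP[p0 p1] t0; elim: N c => [|N IH] c /=.
  rewrite expr0 mulr1; case: (leP c 0) => /= c0; last exact: expR_ge0.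
  by rewrite -expR0 ler_expR oppr_ge0 mulr_ge0_le0.
have shift a : wprob p N (fun s => c <= ((a == b) + count (pred1 b) s)%:R) =
    wprob p N (fun s => c - (a == b)%:R <= (count (pred1 b) s)%:R).
  by apply: eq_wprob => s; rewrite natrD lerBlDl.
rewrite !shift.
set G := (1 + _) in IH *; rewrite exprS.
have expS : expR (- (t * (c - 1))) = expR (- (t * c)) * expR t.
  by rewrite -expRD; congr expR; ring.
have := ler_wpM2l p0 (IH (c - (true == b)%:R)).
have := ler_wpM2l (_ : 0 <= 1 - p) (IH (c - (false == b)%:R)).
rewrite subr_ge0 => /(_ p1) lef let_.
apply: le_trans (lerD let_ lef) _.
rewrite /G; case: (b) => /=; rewrite subr0 expS le_eqVlt;
  apply/orP; left; apply/eqP; ring.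
Qed.

(** Chernoff bound, with parameter [t = e / 4] in [wprob_count_ge]; the rate
    follows from [expR t <= 1 + t + 2 * t ^+ 2]. *)
Lemma wprob_deviation (R : realType) (p e : R) (b : bool) :
  0 <= p <= 1 -> 0 < e <= 1 -> exists2 r : R, 0 <= r < 1 & forall N,
  wprob p N (fun s => ((if b then p else 1 - p) + e) * N%:R <=
                      (count (pred1 b) s)%:R) <= r ^+ N.
Proof.
move=> p01 /andP[e0 e1]; set q := if b then _ else _.
have /andP[q0 q1] : 0 <= q <= 1 by rewrite /q; case: (b); lra.
pose t := e / 4%:R.
have exp_le : expR t <= 1 + t + 2 * t ^+ 2.
  have t1 : 0 < 1 - t by rewrite /t; lra.
  have := expR_ge1Dx (- t); rewrite expRN => le1.
  have : (1 - t) * expR t <= 1.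
    by rewrite -ler_pdivlMr ?expR_gt0 // mul1r.
  rewrite mulrC -ler_pdivlMr // => /le_trans; apply.
  rewrite ler_pdivrMr //.
  have : 0 <= t ^+ 2 * (1 - 2 * t) by rewrite mulr_ge0 ?sqr_ge0 // /t; lra.
  nra.
exists (expR (- (e ^+ 2 / 8%:R))).
  by rewrite expR_ge0 expR_lt1 oppr_lt0 divr_gt0 ?exprn_gt0.
move=> N; apply: le_trans (wprob_count_ge _ _ N p01 (_ : 0 <= t)) _.
  by rewrite /t; lra.
rewrite -/q.
have -> : - (t * ((q + e) * N%:R)) = N%:R * - (t * (q + e)) by ring.
rewrite expRM_natl -exprMn.
apply: lerXn2r; rewrite ?nnegrE ?mulr_ge0 ?expR_ge0 //.
  by rewrite addr_ge0 // mulr_ge0 // subr_ge0 -expR0 ler_expR /t; lra.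
have le2 : 1 + q * (expR t - 1) <= expR (q * (t + 2 * t ^+ 2)).
  apply: le_trans (expR_ge1Dx _); rewrite lerD2l ler_wpM2l //; lra.
apply: le_trans (ler_wpM2l (expR_ge0 _) le2) _.
rewrite -expRD ler_expR /t.
nra.
Qed.

Lemma bernoulli_ge (R : realType) (v : R) m :
  0 <= v <= 1 -> 1 - m%:R * (1 - v) <= v ^+ m.
Proof.
move=> /andP[v0 v1]; elim: m => [|m IH]; first by rewrite mul0r subr0 expr0.
rewrite exprS -natr1; have := ler_wpM2l v0 IH.
have := ler0n R m; have : 0 <= m%:R * ((1 - v) ^+ 2) by rewrite mulr_ge0 ?sqr_ge0.
nra.
Qed.

Lemma bernoulli_gt (R : realType) (v : R) m :
  0 < v < 1 -> 1 - m.+2%:R * (1 - v) < v ^+ m.+2.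
Proof.
move=> /andP[v0 v1]; have := @bernoulli_ge _ v m.+1.
rewrite (ltW v0) (ltW v1) => /(_ isT) /(ler_wpM2l (ltW v0)).
rewrite -exprS -[m.+2%:R]natr1; apply: lt_le_trans.
have : 0 < m.+1%:R * ((1 - v) ^+ 2) by rewrite mulr_gt0 ?exprn_gt0 ?ltr0n ?subr_gt0.
nra.
Qed.

(** With [G = p * v ^+ k + (1 - p)] the mean of
    [v ^+ (1 + increment of the debt)], the process
    [v ^+ height * (v / G) ^+ time] is a martingale until the walk goes below
    [0].  Nonpositive drift enters through [v < G], which is the strict
    Bernoulli inequality for [p * k <= 1]: the factor [g = v / G] is then less
    than [1] and the paths that survive for long contribute little.  The
    conclusion is the optional stopping bound, proved by induction on the
    length. *)
Lemma wprob_survives (R : realType) (p v : R) k : (2 <= k)%N ->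
  0 <= p <= 1 / k%:R -> 0 < v < 1 ->
  exists2 g : R, 0 <= g < 1 &
  forall N h, wprob p N (survives k h) <= 1 - v ^+ h.+1 + g ^+ N.
Proof.
move=> k2 /andP[p0 pk] v01; have /andP[v0 v1] := v01.
have kgt0 : 0 < k%:R :> R by rewrite ltr0n; lia.
have pk1 : p * k%:R <= 1 by rewrite -ler_pdivlMr.
have p1 : p <= 1.
  by apply: le_trans pk _; rewrite ler_pdivrMr // mul1r ler1n; lia.
pose G := p * v ^+ k + (1 - p).
have vG : v < G.
  have [pz|pn0] := eqVneq p 0; first by rewrite /G pz mul0r; lra.
  have pgt0 : 0 < p by rewrite lt_neqAle eq_sym pn0.
  have : 1 - k%:R * (1 - v) < v ^+ k
    by case: k k2 {kgt0 pk pk1 G} => [|[|k]] // _; exact: bernoulli_gt.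
  rewrite -(ltr_pM2l pgt0) /G.
  have : p * k%:R * (1 - v) <= 1 * (1 - v) by rewrite ler_wpM2r // subr_ge0 ltW.
  nra.
have G0 : 0 < G by apply: lt_trans vG.
exists (v / G).
  by rewrite divr_ge0 ?ltW //= ltr_pdivrMr // mul1r.
set g := v / G.
have g0 : 0 <= g by rewrite divr_ge0 // ltW.
have g1 : g <= 1 by rewrite ler_pdivrMr // mul1r ltW.
have gG : g * G = v by rewrite /g mulfVK ?gt_eqF.
elim=> [|N IH] h.
  rewrite /= expr0; have : v ^+ h.+1 <= 1 by rewrite exprn_ile1 ?ltW //.
  by case: k {k2 pk kgt0 pk1 G vG G0 g g0 g1 gG} => *; lra.
have step : wprob p N.+1 (survives k h) <= 1 - v ^+ h * G + g ^+ N.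
  have IHt := ler_wpM2l p0 (IH (h + k.-1)%N).
  have p1' : 0 <= 1 - p by rewrite subr_ge0.
  have IHf : wprob p N (fun s => survives k h (false :: s)) <=
      1 - v ^+ h + g ^+ N.
    case: h {IHt} => [|h] /=; last exact: IH.
    by rewrite wprob_false expr0 subrr add0r exprn_ge0.
  have := lerD IHt (ler_wpM2l p1' IHf).
  have -> : ((h + k.-1).+1 = h + k)%N by rewrite -addnS prednK // ltnW.
  by move=> /le_trans; apply; rewrite exprD /G; lra.
have [le|/ltW ge] := leP (v ^+ h.+1) (g ^+ N.+1).
  apply: le_trans (wprob_le1 _ _ _) _; first by rewrite p0.
  lra.
apply: le_trans step _.
have gpos : 0 < g by rewrite divr_gt0.
have vS : v ^+ h.+1 = g * (v ^+ h * G).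
  by rewrite exprS -gG -mulrA [G * _]mulrC gG.
have {}ge : g ^+ N <= v ^+ h * G by move: ge; rewrite vS exprS ler_pM2l.
have : 0 <= (v ^+ h * G - g ^+ N) * (1 - g) by rewrite mulr_ge0 ?subr_ge0.
by rewrite vS exprS; lra.
Qed.

(** * From words to the probability space *)

Definition plus (T : Type) (R : realType) (eps : nat -> T -> R) (w : T)
    (n : nat) : bool :=
  eps n w == 1.

Definition window (T : Type) (R : realType) (eps : nat -> T -> R) (w : T)
    (n N : nat) : seq bool :=
  [seq plus eps w i | i <- iota n N].

Lemma windowS (T : Type) (R : realType) (eps : nat -> T -> R) (w : T) n N :
  window eps w n N.+1 = plus eps w n :: window eps w n.+1 N.
Proof. by []. Qed.

Lemma measurable_plus d (T : measurableType d) (R : realType)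
    (P : probability T R) (eps : nat -> {RV P >-> R}) n b :
  measurable [set w | plus eps w n = b].
Proof.
have m1 : measurable (eps n @^-1` [set 1]).
  by rewrite -[X in measurable X]setTI; apply: measurable_funP.
case: b; last apply measurableC in m1.
  rewrite (_ : [set w | _] = eps n @^-1` [set 1]) //.
  by apply/seteqP; split=> w /eqP.
rewrite (_ : [set w | _] = ~` (eps n @^-1` [set 1])) //.
by apply/seteqP; split=> w /= => [/eqP//|/eqP/negbTE].
Qed.

Lemma measurable_window d (T : measurableType d) (R : realType)
    (P : probability T R) (eps : nat -> {RV P >-> R}) n N
    (A : pred (seq bool)) :
  measurable [set w | A (window eps w n N)].
Proof.
elim: N n A => [|N IH] n A.
  rewrite (_ : [set w | _] = [set _ | A [::]]) //.
  by case: (A [::]);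
    [rewrite (_ : [set _ | _] = setT) | rewrite (_ : [set _ | _] = set0)] => //;
    apply/seteqP; split.
rewrite (_ : [set w | _] =
  ([set w | plus eps w n = true] `&`
     [set w | A (true :: window eps w n.+1 N)]) `|`
  ([set w | plus eps w n = false] `&`
     [set w | A (false :: window eps w n.+1 N)])).
  apply: measurableU; apply: measurableI; try exact: measurable_plus.
    exact: (IH n.+1 (fun s => A (true :: s))).
  exact: (IH n.+1 (fun s => A (false :: s))).
apply/seteqP; split=> w /=; rewrite windowS; case: (plus eps w n).
- by left.
- by right.
- by case=> -[].
- by case=> -[].
Qed.

Definition word_weight (R : realType) (p : R) (s : seq bool) : R :=
  \prod_(x <- s) (if x then p else 1 - p).

Lemma prob_cylinder d (T : measurableType d) (R : realType)
    (P : probability T R) (eps : nat -> {RV P >-> R}) (p : R) n (s : seq bool) :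
  (forall m, (1 <= m)%N -> P [set w | eps m w = 1] = p%:E) ->
  mutually_independent_RV [set m | (1 <= m)%N] eps -> (1 <= n)%N ->
  P [set w | window eps w n (size s) = s] = (word_weight p s)%:E.
Proof.
move=> eps1 ind n1.
pose J := [fset i in iota n (size s)]%fset.
pose B i : set R := if nth true s (i - n) then [set 1] else ~` [set 1].
have inJ i : (i \in J) = (n <= i < n + size s)%N by rewrite !inE mem_iota.
have mB i : measurable (B i).
  by rewrite /B; case: ifP => _ //; exact: measurableC.
have PB i : (1 <= i)%N ->
    P (eps i @^-1` B i) = (if nth true s (i - n) then p else 1 - p)%:E.
  move=> i1; rewrite /B; case: ifP => _; first exact: eps1.
  rewrite -preimage_setC probability_setC; first by rewrite (eps1 i i1).
  by rewrite -[X in measurable X]setTI; apply: measurable_funP.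
rewrite (_ : [set w | _] = \bigcap_(i in [set` J]) (eps i @^-1` B i)).
  rewrite (ind J B); first last.
  - by move=> i _; exact: mB.
  - by move=> i /=; rewrite inJ; lia.
  rewrite (eq_big_seq (fun i => (if nth true s (i - n) then p else 1 - p)%:E));
    last by move=> i; rewrite inJ => iJ; apply: PB; lia.
  rewrite prodEFin; congr (_%:E).
  rewrite (perm_big (iota n (size s))) /=; last first.
    by apply: uniq_perm; rewrite ?fset_uniq ?iota_uniq // => i; rewrite inJ mem_iota.
  rewrite /word_weight (big_nth true) -{1}[n]addn0 iotaDl big_map /index_iota subn0.
  by apply: eq_bigr => i _; rewrite addKn.
apply/seteqP; split=> w /=.
  move=> ws i /=; rewrite inJ => iJ; rewrite /B.
  have -> : nth true s (i - n) = plus eps w i.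
    rewrite -ws /window (nth_map 0%N) ?size_iota; last by lia.
    by rewrite nth_iota ?subnKC //; lia.
  by rewrite /plus; case: ifPn => /eqP.
move=> wB; apply: (@eq_from_nth _ true); rewrite size_map size_iota // => i si.
rewrite /window (nth_map 0%N) ?size_iota // nth_iota //.
have := wB (n + i)%N; rewrite /= inJ /B addKn => /(_ _)/wrap[]; first by lia.
rewrite /plus; case: (nth true s i) => /=; first by move->; rewrite eqxx.
by move=> /eqP/negbTE.
Qed.

(** Conditioning on a cylinder makes the induction on [N] go through: the
    cylinder is split by the next sign. *)
Lemma prob_cylinder_window d (T : measurableType d) (R : realType)
    (P : probability T R) (eps : nat -> {RV P >-> R}) (p : R) n :
  (forall m, (1 <= m)%N -> P [set w | eps m w = 1] = p%:E) ->
  mutually_independent_RV [set m | (1 <= m)%N] eps -> (1 <= n)%N ->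
  forall N (s : seq bool) (A : pred (seq bool)),
  P ([set w | window eps w n (size s) = s] `&`
     [set w | A (window eps w (n + size s) N)]) =
  (word_weight p s * wprob p N A)%:E.
Proof.
move=> eps1 ind n1; elim=> [|N IH] s A.
  rewrite /window /=; case: (A [::]).
    rewrite mulr1 -(prob_cylinder _ eps1 ind n1); congr (P _).
    by apply/seteqP; split=> w /=; [case|].
  rewrite mulr0 (_ : _ `&` _ = set0) ?measure0 //.
  by apply/seteqP; split=> w // -[].
pose E b := [set w | window eps w n (size s).+1 = rcons s b] `&`
            [set w | A (b :: window eps w (n + size s).+1 N)].
have mE b : measurable (E b).
  apply: measurableI.
    rewrite (_ : [set w | _] =
      [set w | (window eps w n (size s).+1 == rcons s b)]).
      exact: (measurable_window eps n (size s).+1 (pred1 (rcons s b))).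
    by apply/seteqP; split=> w /eqP.
  exact: (measurable_window eps _ N (fun t => A (b :: t))).
have split_window w b : window eps w n (size s).+1 = rcons s b <->
    window eps w n (size s) = s /\ plus eps w (n + size s) = b.
  rewrite /window -[(size s).+1]addn1 iotaD map_cat /= cats1; split=> [/eqP|[-> ->]] //.
  by rewrite eqseq_rcons => /andP[/eqP -> /eqP ->].
rewrite (_ : _ `&` _ = E true `|` E false); last first.
  apply/seteqP; split=> w /=; rewrite windowS.
    move=> [ws Aw]; move: Aw; case wb : (plus eps w (n + size s)) => Aw; [left|right].
      by split=> //=; apply/split_window.
    by split=> //=; apply/split_window.
  by move=> [] [/split_window[ws ->]].
have -> : P (E true `|` E false) = (P (E true) + P (E false))%E.
  apply: measureU => //; apply/seteqP; split=> w //.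
  by move=> [[/split_window[_ e1] _] [/split_window[_ e2] _]];
    have := etrans (esym e1) e2.
have PE b : P (E b) =
    (word_weight p (rcons s b) * wprob p N (fun t => A (b :: t)))%:E.
  by rewrite -IH size_rcons addnS.
rewrite !PE -EFinD /word_weight -!cats1 !big_cat !big_seq1 /=; congr (_%:E).
ring.
Qed.

Lemma prob_window d (T : measurableType d) (R : realType)
    (P : probability T R) (eps : nat -> {RV P >-> R}) (p : R) n N
    (A : pred (seq bool)) :
  (forall m, (1 <= m)%N -> P [set w | eps m w = 1] = p%:E) ->
  mutually_independent_RV [set m | (1 <= m)%N] eps -> (1 <= n)%N ->
  P [set w | A (window eps w n N)] = (wprob p N A)%:E.
Proof.
move=> eps1 ind n1.
have := prob_cylinder_window eps1 ind n1 N [::] A.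
rewrite /word_weight big_nil mul1r addn0 => <-; congr (P _).
by apply/seteqP; split=> w /=; [split|case].
Qed.

(** * Almost sure behaviour of the idle times *)

(** By [height_balance] the error is the height minus [k] times the deviation of
    the number of plus signs from its mean.  By [height_since_idle] the height
    is [k] times a difference of two such deviations plus the drift over a time
    interval, which is nonpositive and can be dropped from an upper bound. *)
Lemma idle_density (R : realType) (p : R) k (b : nat -> bool) : (0 < k)%N ->
  0 <= p <= 1 / k%:R ->
  (forall j : nat, \forall N \near \oo,
     `|(count b (iota 1 N))%:R - p * N%:R| <= j.+1%:R^-1 * N%:R) ->
  (fun N => (count (idle k b) (iota 1 N))%:R / N%:R : R) @ \oo --> 1 - k%:R * p.
Proof.
move=> k0 /andP[p0 pk] dev.
have kR0 : 0 < k%:R :> R by rewrite ltr0n.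
have k1 : 1 <= k%:R :> R by rewrite ler1n.
have pk1 : p * k%:R <= 1 by rewrite -ler_pdivlMr.
have p1 : p <= 1 by nra.
apply/cvgrPdist_le => e e0.
have e6 : 0 < e / (6 * k%:R) by rewrite divr_gt0 ?mulr_gt0.
pose j := Num.truncn (e / (6 * k%:R))^-1.
pose t : R := j.+1%:R^-1.
have t0 : 0 <= t by rewrite invr_ge0.
have te : 6 * k%:R * t <= e.
  rewrite mulrC -ler_pdivlMr ?mulr_gt0 // -[X in _ <= X]invrK.
  rewrite lef_pV2 ?posrE ?invr_gt0 // ltW //.
  have inv0 : 0 <= (e / (6 * k%:R))^-1 by rewrite invr_ge0 ltW.
  by have /andP[] := truncn_itv inv0.
have [M _ devM] := dev j.
have dev_all m : `|(count b (iota 1 m))%:R - p * m%:R| <= t * m%:R + M%:R.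
  have m0 := ler0n R m; have [Mm|mM] := leqP M m.
    by apply: le_trans (devM m Mm) _; rewrite lerDl.
  have cm : ((count b (iota 1 m))%:R <= m%:R :> R).
    by rewrite ler_nat; have := count_size b (iota 1 m); rewrite size_iota.
  have mMR : m%:R <= M%:R :> R by rewrite ler_nat ltnW.
  have c0 := ler0n R (count b (iota 1 m)).
  rewrite ler_norml; apply/andP; split; nra.
have step N : `|(count (idle k b) (iota 1 N))%:R - (1 - k%:R * p) * N%:R| <=
    3 * k%:R * (t * N%:R + M%:R).
  (* The constant [3]: one deviation at [N] from the balance, one at [N] and
     one at [m] from the height. *)
  have [m mN winE] := height_since_idle b N k0.
  have {winE} := congr1 (fun n => n%:R : R) winE.
  have := congr1 (fun n => n%:R : R) (height_balance b N k0).
  rewrite !(natrD, natrM).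
  have : m%:R <= N%:R :> R by rewrite ler_nat.
  have := dev_all N; have := dev_all m.
  have := ler0n R (height k b N); have := ler0n R m; have := ler0n R M.
  set h := (height k b N)%:R; set cN := (count b (iota 1 N))%:R.
  set cm := (count b (iota 1 m))%:R; set i := (count (idle k b) _)%:R.
  set N' := N%:R; set m' := m%:R; set M' := M%:R.
  move=> M0 m0 h0 devm devN mN' bal win.
  have tm : t * m' <= t * N' by rewrite ler_wpM2l.
  have hE : h = k%:R * (cN - p * N') - k%:R * (cm - p * m') -
      (1 - p * k%:R) * (N' - m').
    lra.
  have drift : 0 <= (1 - p * k%:R) * (N' - m') by rewrite mulr_ge0 ?subr_ge0.
  have ktm := ler_wpM2l (ltW kR0) tm.
  have scale (x y : R) : `|x| <= y -> - (k%:R * y) <= k%:R * x <= k%:R * y.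
    by rewrite ler_norml -mulrN !ler_pM2l.
  have /andP[kN1 kN2] := scale _ _ devN; have /andP[km1 km2] := scale _ _ devm.
  rewrite ler_norml.
  have -> : i = h + N' - k%:R * cN by lra.
  apply/andP; split; lra.
near=> N.
have N0 : 0 < N%:R :> R by rewrite ltr0n; near: N; exists 1%N.
have NM : 6 * k%:R * M%:R / e <= N%:R by near: N; exact: nbhs_infty_ger.
rewrite ler_pdivrMr // in NM.
rewrite distrC -(mulfK (lt0r_neq0 N0) (1 - _)) -mulrBl.
rewrite normrM normfV (ger0_norm (ltW N0)).
rewrite ler_pdivrMr //; apply: le_trans (step N) _.
have := ler_wpM2r (ltW N0) te; lra.
Unshelve. all: by end_near. Qed.

Lemma sum_indic_count (R : realType) (a : pred nat) N :
  \sum_(1 <= m < N.+1) \1_[set m | a m] m = (count a (iota 1 N))%:R :> R.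
Proof.
elim: N => [|N IH]; first by rewrite big_geq.
rewrite count_iotaS natrD -IH big_nat_recr //= indicE; congr (_ + _).
by congr (_%:R); congr nat_of_bool; apply/idP/idP; rewrite inE.
Qed.

Lemma ae_sign d (T : measurableType d) (R : realType)
    (P : probability T R) (eps : nat -> {RV P >-> R}) (p : R) :
  (forall n, (1 <= n)%N -> P [set w | eps n w = 1] = p%:E) ->
  (forall n, (1 <= n)%N -> P [set w | eps n w = -1] = (1 - p)%:E) ->
  {ae P, forall w n, (1 <= n)%N ->
    eps n w = if plus eps w n then 1 else -1}.
Proof.
move=> epsp epsm; apply: ae_foralln => n.
case: n => [|n]; first by apply: aeW.
have mE (x : R) : measurable [set w | eps n.+1 w = x].
  by rewrite -[[set w | _]]setTI;
    exact: (measurable_funP (eps n.+1) _ _ (measurable_set1 x)).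
pose E := [set w | eps n.+1 w = 1] `|` [set w | eps n.+1 w = -1].
have mU : measurable E by apply: measurableU.
have PE1 : P E = 1%E.
  have -> : P E =
      (P [set w | eps n.+1 w = 1%R] + P [set w | eps n.+1 w = (-1)%R])%E.
    apply: measureU => //; apply/seteqP; split=> w // [/= e1 e2].
    by have := etrans (esym e1) e2; lra.
  by rewrite epsp // epsm // -EFinD addrCA subrr addr0.
have PE : P (~` E) = 0%E by rewrite probability_setC // PE1 subee.
exists (~` E); split=> //; first exact: measurableC.
move=> w /=; apply: contra_not => Ew _; rewrite /plus.
by case: Ew => /= ->; [rewrite eqxx | case: eqP].
Qed.

(** Borel-Cantelli applied to the Chernoff bound. *)
Lemma ae_count_lt d (T : measurableType d) (R : realType)
    (P : probability T R) (eps : nat -> {RV P >-> R}) (p e : R) (b : bool) :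
  (forall n, (1 <= n)%N -> P [set w | eps n w = 1] = p%:E) ->
  mutually_independent_RV [set n | (1 <= n)%N] eps ->
  0 <= p <= 1 -> 0 < e <= 1 ->
  {ae P, forall w, \forall N \near \oo,
     (count (pred1 b) (window eps w 1 N))%:R <
     ((if b then p else 1 - p) + e) * N%:R}.
Proof.
move=> eps1 ind p01 e01; have [r /andP[r0 r1] wr] := wprob_deviation b p01 e01.
set q := (if b then _ else _) in wr *.
pose A N (s : seq bool) := (q + e) * N%:R <= (count (pred1 b) s)%:R.
pose E N := [set w | A N (window eps w 1 N)].
have mE N : measurable (E N) by exact: measurable_window.
have PE N : (P (E N) <= (r ^+ N)%:E)%E.
  by rewrite /E (prob_window _ _ eps1 ind) // lee_fin.
have E0 : P (lim_sup_set E) = 0.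
  apply: lim_sup_set_cvg0 => //.
  apply: (@le_lt_trans _ _ (\sum_(n <oo) (r ^+ n)%:E)%E).
    by apply: lee_nneseries => n *; [exact: measure_ge0 | exact: PE].
  have cvr : cvgn (series (geometric 1 r)).
    by apply: is_cvg_geometric_series; rewrite ger0_norm.
  rewrite (_ : (fun n => _) = EFin \o series (geometric 1 r)).
    by rewrite EFin_lim // ltry.
  apply/funext => n /=; rewrite /series /= sumEFin; congr (_%:E).
  by apply: eq_bigr => i _; rewrite mul1r.
exists (lim_sup_set E); split=> //.
  by apply: bigcap_measurable => // n _; exact: bigcup_measurable.
move=> w /= Nw n _; apply: contrapT => nE; apply: Nw.
exists n => // N /= nN; rewrite ltNge; apply/negP => le; apply: nE.
by exists N.
Qed.

(** The strong law of large numbers for the number of plus signs: the upper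
    deviations of the number of minus signs are the lower deviations of the
    number of plus signs. *)
Lemma ae_count_dev d (T : measurableType d) (R : realType)
    (P : probability T R) (eps : nat -> {RV P >-> R}) (p : R) :
  (forall n, (1 <= n)%N -> P [set w | eps n w = 1] = p%:E) ->
  mutually_independent_RV [set n | (1 <= n)%N] eps ->
  0 <= p <= 1 ->
  {ae P, forall w (j : nat), \forall N \near \oo,
    `|(count (plus eps w) (iota 1 N))%:R - p * N%:R| <= j.+1%:R^-1 * N%:R}.
Proof.
move=> eps1 ind p01; apply: ae_foralln => j.
have e01 : 0 < (j.+1%:R^-1 : R) <= 1.
  by rewrite invr_gt0 ltr0n invf_le1 ?ltr0n // ler1n.
have := ae_count_lt true eps1 ind p01 e01.
have := ae_count_lt false eps1 ind p01 e01.
apply: filterS2 => w; apply: filterS2 => N /=.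
have cT : count (pred1 true) (window eps w 1 N) = count (plus eps w) (iota 1 N).
  by rewrite count_map; apply: eq_count => i /=; case: (plus _ _ _).
have cF : (count (plus eps w) (iota 1 N) +
    count (pred1 false) (window eps w 1 N) = N)%N.
  rewrite -[RHS](size_iota 1 N) -(count_predC (plus eps w)) count_map.
  by congr addn; apply: eq_count => i /=; case: (plus _ _ _).
have := congr1 (fun m => m%:R : R) cF; rewrite cT natrD.
move: (j.+1%:R^-1) (N%:R) => t n.
move: (_%:R) => c; move: (_%:R) => c' sumN ltF ltT.
by rewrite ler_norml; apply/andP; split; lra.
Qed.

(** The bound [1 - v ^+ h.+1 + g ^+ N] of [wprob_survives] tends to [0] when
    first [N] goes to infinity and then [v] to [1]. *)
Lemma ae_not_survives d (T : measurableType d) (R : realType)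
    (P : probability T R) (eps : nat -> {RV P >-> R}) (p : R) k n h :
  (forall n, (1 <= n)%N -> P [set w | eps n w = 1] = p%:E) ->
  mutually_independent_RV [set n | (1 <= n)%N] eps ->
  (2 <= k)%N -> 0 <= p <= 1 / k%:R -> (1 <= n)%N ->
  {ae P, forall w, exists N, ~~ survives k h (window eps w n N)}.
Proof.
move=> eps1 ind k2 pk n1.
pose E N := [set w | survives k h (window eps w n N)].
have mE N : measurable (E N) by exact: measurable_window.
have mI : measurable (\bigcap_N E N) by apply: bigcap_measurable.
exists (\bigcap_N E N); split=> //; last first.
  move=> w /= Nw N _; rewrite /E /=; apply: contrapT => /negP sN.
  by apply: Nw; exists N.
apply/eqP; rewrite eq_le measure_ge0 andbT; apply/lee_addgt0Pr => e e0.
rewrite add0e.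
have h0 : 0 < h.+1%:R :> R by rewrite ltr0n.
(* For [v = 1 - dl], Bernoulli's inequality bounds [1 - v ^+ h.+1] by half of
   [e]; the other half is left for [g ^+ N]. *)
pose dl : R := Num.min (1 / 2%:R) (e / (2%:R * h.+1%:R)).
have d0 : 0 < dl by rewrite lt_min !divr_gt0 ?mulr_gt0.
have d1 : dl <= 1 / 2%:R by rewrite ge_min lexx.
have d2 : 2 * h.+1%:R * dl <= e.
  by rewrite mulrC -ler_pdivlMr ?mulr_gt0 // ge_min lexx orbT.
have v01 : 0 < 1 - dl < 1 by lra.
have [g /andP[g0 g1] bound] := wprob_survives k2 pk v01.
have [N gN] : exists N, g ^+ N <= e / 2%:R.
  have : geometric 1 g @ \oo --> (0 : R) by apply: cvg_geometric; rewrite ger0_norm.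
  move=> /cvgrPdist_le /(_ (e / 2%:R)) [|N _ /(_ N (leqnn N))].
    by rewrite divr_gt0.
  rewrite /= sub0r normrN mul1r ger0_norm ?exprn_ge0 // => gN.
  by exists N.
apply: (@le_trans _ _ (P (E N))).
  by apply: le_measure; rewrite ?inE //; apply: bigcap_inf.
rewrite /E (prob_window _ (survives k h) eps1 ind) // lee_fin.
apply: le_trans (bound N h) _.
have := @bernoulli_ge _ (1 - dl) h.+1; rewrite (_ : 0 <= 1 - dl <= 1); last lra.
by move=> /(_ isT); rewrite opprB addrCA subrr addr0; lra.
Qed.

(** The debt at time [n] is random but bounded by [k.-1 * n], and a larger
    initial debt survives longer; so one deterministic initial debt suffices for
    each [n]. *)
Lemma ae_idle_infinitely_often d (T : measurableType d) (R : realType)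
    (P : probability T R) (eps : nat -> {RV P >-> R}) (p : R) k :
  (forall n, (1 <= n)%N -> P [set w | eps n w = 1] = p%:E) ->
  mutually_independent_RV [set n | (1 <= n)%N] eps ->
  (2 <= k)%N -> 0 <= p <= 1 / k%:R ->
  {ae P, forall w n, exists m, (n <= m)%N && idle k (plus eps w) m}.
Proof.
move=> eps1 ind k2 pk; apply: ae_foralln => n.
have := ae_not_survives (k.-1 * n) eps1 ind k2 pk (ltn0Sn n).
apply: filterS => w [N /negP nsurv]; apply: contrapT => noidle; apply: nsurv.
apply: (survives_homo (height_le k (plus eps w) n)).
apply: survives_no_idle => m nm; apply/negP => im; apply: noidle.
by exists m; rewrite im ltnW.
Qed.

Theorem theorem1p2 (R : realType) (d : measure_display) (T : measurableType d)
    (P : probability T R) (k : nat) (p f1 f2 : R)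
    (eps : nat -> {RV P >-> R}) (F : nat -> T -> R)
    (hk : (3 <= k)%N)
    (hp : 0 <= p <= 1 / k%:R)
    (eps_plus : forall n, (1 <= n)%N -> P [set w | eps n w = 1] = p%:E)
    (eps_minus : forall n, (1 <= n)%N -> P [set w | eps n w = -1] = (1 - p)%:E)
    (eps_indep : mutually_independent_RV [set n | (1 <= n)%N] eps)
    (f1_gt0 : 0 < f1) (f2_gt0 : 0 < f2)
    (hF1 : forall w, F 1%N w = f1)
    (hF2 : forall w, F 2%N w = f2)
    (hF : random_fibonacci (2 * cos (pi / k%:R)) (fun n => eps n) F) :
  {ae P, forall w, exists nu : nat -> nat,
    [/\ (1 <= nu 0)%N,
        (forall j, (nu j < nu j.+1)%N),
        (exists M : R, forall j, `|F (nu j) w| <= M)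
      & has_natural_density (range nu) (1 - k%:R * p)]}.
Proof.
have p01 : 0 <= p <= 1.
  case/andP: hp => -> /le_trans /=; apply.
  by rewrite ler_pdivrMr ?mul1r ?ler1n ?ltr0n; lia.
have := ae_idle_infinitely_often eps_plus eps_indep (ltnW hk) hp.
have := ae_count_dev eps_plus eps_indep p01.
have := ae_sign eps_plus eps_minus.
apply: filterS3 => w sign dev /enumerate_infinite[nu [nuS nuE]].
have idle_nu j : idle k (plus eps w) (nu j).
  by have : range nu (nu j) by [exists j]; rewrite nuE.
exists nu; split=> //; first by have /and3P[] := idle_nu 0%N.
  set C := energy (2 * cos (pi / k%:R)) (f1, f2).
  exists (1 + C / sin (pi / k%:R) ^+ 2) => j.
  have /and3P[nu0 /eqP h0 _] := idle_nu j.
  have red n : reduced k C (height k (plus eps w) n) (F n.+1 w, F n.+2 w).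
    apply: (reduced_orbit (f := F ^~ w)) => //.
    - by rewrite /nonneg_pair /= hF1 hF2 !ltW.
    - by rewrite hF1 hF2.
    - by move=> m m0; rewrite hF // [eps m w]sign.
  have := red (nu j).-1; rewrite h0 prednK // => redj.
  have /andP[/= Fge0 _] := reduced_nonneg redj.
  rewrite ger0_norm //; exact: (reduced0_bounded (ltnW hk) redj).
have := idle_density (ltnW (ltnW hk)) hp dev; rewrite /has_natural_density nuE.
by under [X in _ -> X @ _ --> _]eq_fun => N do rewrite sum_indic_count.
Qed.
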